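(* The probability mass function $h_r^{(III)}(n)$ of the random variable $T_{r,k}^{(III)}$ satisfies the recursive scheme $$h_{r}^{(III)}(n)=h_{r}^{(III)}(n-1)-p^{k}q\,h_{r}^{(III)}(n-k-1)+p\,h_{r-1}^{(III)}(n-1)-p\,h_{r-1}^{(III)}(n-2)+p^{k}q\,h_{r-1}^{(III)}(n-k-1).$$
   Context: $(X_i)_{i\ge1}$ is an infinite sequence of independent Bernoulli trials with $P(X_i=1)=p$, $0<p<1$, and $P(X_i=0)=q=1-p$. For $r=1,2,\dots$, $T_{r,k}^{(III)}$ is the waiting time until the $r$-th occurrence of a success run of length $k$ under the overlapping counting scheme (an uninterrupted sequence of $m\ge k$ successes, preceded and followed by a failure or by the beginning or end of the sequence, accounts for $m-k+1$ success runs of length $k$), and $h_r^{(III)}(n)=P(T_{r,k}^{(III)}=n)$. For $r=0$ the probability generating function is taken to be $1$, i.e. $h_0^{(III)}(n)=1$ if $n=0$ and $0$ otherwise.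
   Formalization: The scheme is proved for all r ≥ 1, k ≥ 1 and all integers n except r = 1, k ≥ 2 with n = 1, 2, k or k+1, where with h_0(n) = 1 if n = 0 and 0 otherwise it is false (e.g. n = 1 would give 0 = p). *)

(* Defs.v *)
From HB Require Import structures.
From mathcomp Require Import all_boot all_order all_algebra finmap.
From mathcomp Require Import all_classical all_reals all_analysis.

Set Implicit Arguments.
Unset Strict Implicit.
Unset Printing Implicit Defensive.

Import Order.TTheory GRing.Theory Num.Theory.

Local Open Scope classical_set_scope.
Local Open Scope ring_scope.

Definition mutually_independent (R : realType) (d d' : measure_display)
    (Omega : measurableType d) (T : measurableType d') (P : probability Omega R)
    (I : choiceType) (X : I -> {RV P >-> T}) : Prop :=
  forall (J : {fset I}) (A : I -> set T), (forall i, measurable (A i)) ->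
    P (\bigcap_(i in [set` J]) (X i @^-1` A i)) =
    (\prod_(i <- J) P (X i @^-1` A i))%E.

(* The trial X_(i+1) of the 1-based sequence is [X i]; [true] is a success
   (value 1) and [false] a failure (value 0). *)
Definition bernoulli_trials (R : realType) (d : measure_display)
    (Omega : measurableType d) (P : probability Omega R)
    (X : nat -> {RV P >-> bool}) (p : R) : Prop :=
  [/\ mutually_independent X,
      forall i, P (X i @^-1` [set true]) = p%:E &
      forall i, P (X i @^-1` [set false]) = (1 - p)%:E].

(* The positions a, ..., b - 1 of s form an uninterrupted sequence of successes,
   preceded by a failure or the beginning of s, and followed by a failure or the
   end of s. *)
Definition maximal_success_run (s : seq bool) (a b : nat) : bool :=
  [&& (a < b <= size s)%N,
      all id (take (b - a) (drop a s)),
      (a == 0)%N || ~~ nth false s a.-1 &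
      (b == size s) || ~~ nth false s b].

(* Overlapping scheme: a maximal run of length m = b - a >= k counts for
   m - k + 1 success runs of length k. *)
Definition overlapping_runs (k : nat) (s : seq bool) : nat :=
  (\sum_(a < (size s).+1)
     \sum_(b < (size s).+1 | maximal_success_run s a b && (k <= b - a))
       (b - a - k + 1))%N.

(* First n at which the outcomes x_0, ..., x_(n-1) contain at least r
   (overlapping) success runs of length k; [None] if this never happens. *)
Definition waiting_time (r k : nat) (x : nat -> bool) : option nat :=
  match pselect (exists n, (r <= overlapping_runs k (mkseq x n))%N) with
  | left ex => Some (ex_minn ex)
  | right _ => None
  end.

(* The argument n is an integer so that the recursive scheme can refer to
   n - k - 1 etc. without truncation; the event is empty for n < 0. *)
Definition hIII (R : realType) (d : measure_display) (Omega : measurableType d)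
    (P : probability Omega R) (X : nat -> {RV P >-> bool}) (k r : nat)
    (n : int) : R :=
  if r is 0%N then (n == 0)%:R
  else fine (P [set w | omap Posz (waiting_time r k (X ^~ w)) = Some n]).

(* Main.v *)
(* Up to the r-th run, the trials form a Markov chain whose state is the length
   of the current success run, capped at k - 1.  Write c_{r,j}(n) for the
   probability that r runs are first completed after n trials from state j, so
   that h_r = c_{r,0}, and put b_r = c_{r,k-1}.  First-step analysis gives
     b_r(n) = p b_{r-1}(n-1) + q h_r(n-1),
   and telescoping the first-step equations of the states 0, ..., k - 1 gives
     h_r(n) - h_r(n-1) = p^k (b_{r-1}(n-k) - b_r(n-k)).
   Eliminating b from these two identities yields the recursive scheme. *)
Require Import Defs.
From HB Require Import structures.
From mathcomp Require Import all_boot all_order all_algebra finmap.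
From mathcomp Require Import all_classical all_reals all_analysis.
From mathcomp Require Import ring zify.

Set Implicit Arguments.
Unset Strict Implicit.
Unset Printing Implicit Defensive.

Import Order.TTheory GRing.Theory Num.Theory.

Local Open Scope classical_set_scope.
Local Open Scope ring_scope.

(** * Overlapping runs counted trial by trial *)

Definition trailing_successes (s : seq bool) : nat := find negb (rev s).

Lemma trailing_successes_rcons (s : seq bool) (b : bool) :
  trailing_successes (rcons s b) = if b then (trailing_successes s).+1 else 0%N.
Proof. by rewrite /trailing_successes rev_rcons; case: b. Qed.

(** A run reaching the end of [s] contains no failure and cannot be prolonged to the left, which
    forces it to be the whole trailing block. The proof appends the trials one at a time. *)
Lemma maximal_success_run_final (s : seq bool) (a : nat) :
  maximal_success_run s a (size s) =
  (a < size s)%N && (a + trailing_successes s == size s)%N.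
Proof.
rewrite /maximal_success_run eqxx /= leqnn !andbT.
have [asz|] := ltnP; last by [].
rewrite take_oversize ?size_drop //=.
elim/last_ind: s asz => [|s x IH]; first by rewrite ltn0.
rewrite size_rcons ltnS leq_eqVlt trailing_successes_rcons.
have drop_all c : all id (drop c (rcons s x)) =
    if (c <= size s)%N then x && all id (drop c s) else true.
  case: ifP => cs; first by rewrite drop_rcons // all_rcons.
  by rewrite drop_oversize // size_rcons ltnNge cs.
rewrite drop_all => /orP[/eqP ->|asz].
  rewrite leqnn drop_size /= andbT nth_rcons.
  case: x drop_all => /= _; last by rewrite addn0 ltn_eqF.
  elim/last_ind: s {IH} => [//|s y _].
  rewrite size_rcons /= ltnSn nth_rcons ltnn eqxx trailing_successes_rcons.
  by case: y; lia.
rewrite (ltnW asz) nth_rcons (leq_ltn_trans (leq_pred a) asz) -andbA IH //.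
by case: x drop_all; lia.
Qed.

Lemma maximal_success_run_rcons_lt (s : seq bool) (x : bool) (a b : nat) :
  (b < size s)%N ->
  maximal_success_run (rcons s x) a b = maximal_success_run s a b.
Proof.
move=> bs; rewrite /maximal_success_run size_rcons.
have [ab|//] := ltnP a b.
rewrite (ltnW bs) leqW ?(ltnW bs) //= drop_rcons; last by lia.
rewrite -cats1 takel_cat ?size_drop; last by lia.
rewrite !nth_rcons bs (_ : a.-1 < size s)%N; last by lia.
by rewrite (ltn_eqF bs) (ltn_eqF (leqW bs)).
Qed.

Lemma maximal_success_run_rcons_size (s : seq bool) (x : bool) (a : nat) :
  maximal_success_run (rcons s x) a (size s) =
  ~~ x && maximal_success_run s a (size s).
Proof.
rewrite /maximal_success_run size_rcons leqnn leqnSn eqxx !andbT /=.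
have [ab|_] := ltnP a (size s); last by rewrite andbF.
rewrite /= drop_rcons; last by lia.
rewrite -cats1 takel_cat ?size_drop; last by lia.
rewrite !nth_rcons ltnn eqxx (_ : a.-1 < size s)%N; last by lia.
by rewrite (ltn_eqF (ltnSn _)) /= andbA andbC.
Qed.

(* Exchanging the sums isolates the final run; truncated subtraction absorbs
   the condition [k <= b - a]. *)
Lemma overlapping_runsE (k : nat) (s : seq bool) :
  overlapping_runs k s =
  (\sum_(b < (size s).+1) \sum_(a < (size s).+1)
     maximal_success_run s a b * ((b - a).+1 - k))%N.
Proof.
rewrite /overlapping_runs.
under eq_bigr do rewrite big_mkcond /=.
rewrite exchange_big /=.
apply: eq_bigr => b _; apply: eq_bigr => a _.
by case: maximal_success_run => /=; first have [|] := leqP k (b - a); lia.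
Qed.

(** Only the final run is affected. A success lengthens it from t to t + 1, and its contribution t +
    1 - k (truncated) grows by one exactly when k <= t + 1. A failure leaves it in place, and the
    new empty final block contributes 1 - k = 0. *)
Lemma overlapping_runs_rcons (k : nat) (s : seq bool) (b : bool) :
  (0 < k)%N ->
  overlapping_runs k (rcons s b) =
  (overlapping_runs k s + (b && (k <= (trailing_successes s).+1)))%N.
Proof.
move=> k_gt0.
pose F t m c := (\sum_(a < m) maximal_success_run t a c * ((c - a).+1 - k))%N.
have final t : F t (size t).+1 (size t) = ((trailing_successes t).+1 - k)%N.
  have t_le : (trailing_successes t <= size t)%N.
    by rewrite -(size_rev t) find_size.
  (* This is the only possible start of a final run. If [t] has no trailing success there is no such
     run, and both sides are 0 because k > 0. *)
  rewrite /F (bigD1 (inord (size t - trailing_successes t))) //=.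
  rewrite inordK ?ltnS ?leq_subr // big1 => [|i /eqP i_neq].
    by rewrite maximal_success_run_final; lia.
  rewrite maximal_success_run_final; case: eqP => [i_eq|]; last by rewrite andbF.
  case: i_neq; apply: val_inj; rewrite /= inordK ?ltnS ?leq_subr //; lia.
have widen t m c : (c < m)%N -> F t m.+1 c = F t m c.
  move=> cm; rewrite /F big_ord_recr /= /maximal_success_run.
  by rewrite (_ : (m < c)%N = false) ?addn0 //; lia.
have runsE t : overlapping_runs k t =
    (\sum_(c < (size t).+1) F t (size t).+1 c)%N := overlapping_runsE k t.
rewrite !runsE size_rcons big_ord_recr /= [in RHS]big_ord_recr /=.
have -> : (\sum_(c < (size s).+1) F (rcons s b) (size s).+2 c =
           \sum_(c < size s) F s (size s).+1 c + ~~ b * F s (size s).+1 (size s))%N.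
  rewrite big_ord_recr /=; congr addn.
    apply: eq_bigr => c _; rewrite widen; last exact: (leqW (ltn_ord c)).
    by apply: eq_bigr => a _; rewrite maximal_success_run_rcons_lt.
  rewrite widen // /F big_distrr /=; apply: eq_bigr => a _.
  by rewrite maximal_success_run_rcons_size mulnA mulnb.
have := final (rcons s b); rewrite size_rcons => ->.
rewrite final trailing_successes_rcons.
by case: b; rewrite /= ?mul0n ?mul1n; lia.
Qed.

Lemma overlapping_runs_nil (k : nat) : overlapping_runs k [::] = 0%N.
Proof. by rewrite overlapping_runsE !big_ord1. Qed.

(** * The waiting time as a first passage *)

Lemma waiting_timeP (r k : nat) (x : nat -> bool) (n : nat) :
  waiting_time r k x = Some n <->
  (r <= overlapping_runs k (mkseq x n))%N /\
  forall m, (m < n)%N -> (overlapping_runs k (mkseq x m) < r)%N.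
Proof.
rewrite /waiting_time; case: pselect => [ex|nex]; last first.
  by split=> // -[rn _]; case: nex; exists n.
case: ex_minnP => m rm m_min; split=> [[<-]|[rn lt_r]].
  by split=> // i im; rewrite ltnNge; apply/negP => /m_min; rewrite leqNgt im.
congr Some; apply/eqP; rewrite eqn_leq m_min //= leqNgt; apply/negP => /lt_r.
by rewrite ltnNge rm.
Qed.

Lemma overlapping_runs_mkseq_mono (k : nat) (x : nat -> bool) (m n : nat) :
  (0 < k)%N -> (m <= n)%N ->
  (overlapping_runs k (mkseq x m) <= overlapping_runs k (mkseq x n))%N.
Proof.
move=> k_gt0; elim: n => [|n IH]; first by rewrite leqn0 => /eqP ->.
rewrite leq_eqVlt ltnS => /orP[/eqP -> //|/IH le_mn].
by rewrite mkseqS overlapping_runs_rcons // (leq_trans le_mn) // leq_addr.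
Qed.

(** * First-step equations and the elimination that yields the scheme *)

(* The probability that, from the state of having [j < k] as the length of the
   current success run capped at [k - 1], exactly [n] further trials are needed
   to complete [r] more runs of length [k]. *)
Fixpoint hit_pmf (R : pzRingType) (p : R) (k n r j : nat) : R :=
  match r, n with
  | 0%N, _ => (n == 0)%N%:R
  | _.+1, 0%N => 0
  | r'.+1, n'.+1 =>
      p * (if (j.+1 < k)%N then hit_pmf p k n' r j.+1
           else hit_pmf p k n' r' j)
      + (1 - p) * hit_pmf p k n' r 0
  end.

Lemma hit_pmf0 (R : pzRingType) (p : R) (k n j : nat) :
  hit_pmf p k n 0 j = (n == 0)%N%:R.
Proof. by case: n. Qed.

(* Extended by 0 to negative times, so that the recursion holds at all times. *)
Definition hit_pmfz (R : pzRingType) (p : R) (k r j : nat) (n : int) : R :=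
  if n is Posz m then hit_pmf p k m r j else 0.

Lemma hit_pmfz0 (R : pzRingType) (p : R) (k j : nat) (n : int) :
  hit_pmfz p k 0 j n = (n == 0)%:R.
Proof. by case: n => [n|//]; rewrite /= hit_pmf0. Qed.

Lemma hit_pmfzS (R : pzRingType) (p : R) (k r j : nat) (n : int) :
  hit_pmfz p k r.+1 j n =
  p * (if (j.+1 < k)%N then hit_pmfz p k r.+1 j.+1 (n - 1)
       else hit_pmfz p k r j (n - 1))
  + (1 - p) * hit_pmfz p k r.+1 0 (n - 1).
Proof.
case: n => [[|n]|n].
- by rewrite /= !if_same !mulr0 addr0.
- by rewrite (_ : n.+1%:Z - 1 = n); last by lia.
- rewrite (_ : Negz n - 1 = Negz n.+1); last by lia.
  by rewrite /= !if_same !mulr0 addr0.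
Qed.

(* The contributions of failures to the values in states [i] and [i.+1] are
   equal, so their difference is [p] times the next such difference. *)
Lemma hit_pmfz_diff (R : comPzRingType) (p : R) (k r i : nat) (n : int) :
  (i < k)%N ->
  hit_pmfz p k r.+1 0 n - hit_pmfz p k r.+1 0 (n - 1) =
  p ^+ i.+1 *
  ((if (i.+1 < k)%N then hit_pmfz p k r.+1 i.+1 (n - i.+1%:Z)
    else hit_pmfz p k r i (n - i.+1%:Z)) - hit_pmfz p k r.+1 i (n - i.+1%:Z)).
Proof.
elim: i => [|i IH] i_lt_k; first
  by rewrite {1}hit_pmfzS -[n - 1%:Z]/(n - 1); ring.
rewrite IH; last exact: ltnW.
rewrite i_lt_k [hit_pmfz p k r.+1 i.+1 (n - i.+1%:Z)]hit_pmfzS.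
rewrite [hit_pmfz p k r.+1 i (n - i.+1%:Z)]hit_pmfzS i_lt_k.
rewrite (_ : n - i.+1%:Z - 1 = n - i.+2%:Z); last by lia.
by rewrite [in RHS]exprS; ring.
Qed.

Lemma hit_pmfz_diff_last (R : comPzRingType) (p : R) (k r : nat) (n : int) :
  (0 < k)%N ->
  hit_pmfz p k r.+1 0 n - hit_pmfz p k r.+1 0 (n - 1) =
  p ^+ k * (hit_pmfz p k r k.-1 (n - k%:Z) - hit_pmfz p k r.+1 k.-1 (n - k%:Z)).
Proof.
case: k => [//|k] _.
by rewrite (@hit_pmfz_diff R p k.+1 r k n (ltnSn k)) ltnn.
Qed.

Lemma hit_pmfzS_last (R : pzRingType) (p : R) (k r : nat) (n : int) :
  (0 < k)%N ->
  hit_pmfz p k r.+1 k.-1 n =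
  p * hit_pmfz p k r k.-1 (n - 1) + (1 - p) * hit_pmfz p k r.+1 0 (n - 1).
Proof. by case: k => [//|k] _; rewrite hit_pmfzS ltnn. Qed.

(** The elimination of b needs the first-step equation at level [r], which fails for r = 0, where
    h_0 and b_0 are both the indicator of 0. There the scheme amounts to p^k ([n = k] - [n = k + 1])
    = p ([n = 1] - [n = 2]): an identity for k = 1, and 0 = 0 away from the four excluded times for
    k >= 2. *)
Lemma hit_pmfz_rec (R : comPzRingType) (p : R) (k r : nat) (n : int) :
  (0 < k)%N ->
  ~ (r = 0%N /\ (2 <= k)%N /\ [\/ n = 1, n = 2, n = k%:Z | n = k%:Z + 1]) ->
  hit_pmfz p k r.+1 0 n =
    hit_pmfz p k r.+1 0 (n - 1)
    - p ^+ k * (1 - p) * hit_pmfz p k r.+1 0 (n - k%:Z - 1)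
    + p * hit_pmfz p k r 0 (n - 1) - p * hit_pmfz p k r 0 (n - 2)
    + p ^+ k * (1 - p) * hit_pmfz p k r 0 (n - k%:Z - 1).
Proof.
move=> k_gt0 excl.
have -> : hit_pmfz p k r.+1 0 n = hit_pmfz p k r.+1 0 (n - 1) +
   (hit_pmfz p k r.+1 0 n - hit_pmfz p k r.+1 0 (n - 1)) by ring.
rewrite hit_pmfz_diff_last // hit_pmfzS_last //.
case: r excl => [|r] excl.
  rewrite !hit_pmfz0; have [k1|k_ge2] := leqP k 1.
    have -> : k = 1%N by lia.
    rewrite -[n - 1%:Z]/(n - 1) (_ : n - 1 - 1 = n - 2); last by lia.
    by rewrite expr1; ring.
  have [n1 [n2 [nk nk1]]] : n <> 1 /\ n <> 2 /\ n <> k%:Z /\ n <> k%:Z + 1.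
    by do ![split] => n_eq; apply: excl; do 2![split=> //];
      [constructor 1|constructor 2|constructor 3|constructor 4].
  do 4![rewrite (_ : (_ == 0) = false); last by apply/eqP; lia].
  by rewrite !mulr0n; ring.
(* The telescoped identity with one run fewer, at time n - 1 and multiplied by p, accounts for p h(n
   - 1) - p h(n - 2). *)
have := @hit_pmfz_diff_last R p k r (n - 1) k_gt0.
rewrite (_ : n - 1 - 1 = n - 2); last by lia.
rewrite (_ : n - 1 - k%:Z = n - k%:Z - 1); last by lia.
move/(congr1 (fun y => p * y)); rewrite mulrBr => /eqP.
rewrite subr_eq => /eqP ->.
by rewrite [hit_pmfz p k r.+1 k.-1 (n - k%:Z)]hit_pmfzS_last //; ring.
Qed.

(** * From the Bernoulli trials to the recursion *)

Definition prefix_weight (R : pzRingType) (p : R) (t : seq bool) : R :=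
  \prod_(b <- t) (if b then p else 1 - p).

Lemma prefix_weight_rcons (R : pzRingType) (p : R) (t : seq bool) (b : bool) :
  prefix_weight p (rcons t b) = prefix_weight p t * (if b then p else 1 - p).
Proof. by rewrite /prefix_weight -cats1 big_cat big_seq1. Qed.

Lemma probability_prefix (R : realType) (d : measure_display)
    (Omega : measurableType d) (P : probability Omega R)
    (X : nat -> {RV P >-> bool}) (p : R) (t : seq bool) :
  bernoulli_trials X p ->
  let A := [set w | mkseq (X ^~ w) (size t) = t] in
  measurable A /\ P A = (prefix_weight p t)%:E.
Proof.
move=> [indep P_true P_false] A.
pose J := [fset i in iota 0 (size t)]%fset.
pose B i := [set nth false t i].
have AE : A = \bigcap_(i in [set` J]) (X i @^-1` B i).
  apply/seteqP; split=> w /=.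
    move=> wt i; rewrite /= !inE mem_iota /= => it.
    by rewrite /B /= -[in RHS]wt nth_mkseq.
  move=> wB; apply: (@eq_from_nth _ false); rewrite size_mkseq // => i it.
  by rewrite nth_mkseq //; apply: wB; rewrite /= !inE mem_iota.
split.
  rewrite AE; apply: fin_bigcap_measurable => // i _.
  exact: measurable_funPTI.
rewrite AE indep //.
have P_B i : P (X i @^-1` B i) = (if nth false t i then p else 1 - p)%:E.
  by rewrite /B; case: nth.
under eq_bigr do rewrite P_B.
rewrite prodEFin /prefix_weight (big_nth false) /index_iota subn0.
congr EFin; apply: perm_big; apply: uniq_perm.
- exact: fset_uniq.
- exact: iota_uniq.
- by move=> i; rewrite !inE.
Qed.

(** This is the Markov property: given the prefix [t], only the number of missing runs and the
    capped trailing block matter. The cap k - 1 loses nothing, since from there on every success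
    completes a run. Induction on [n] splits the event by the next trial. *)
Lemma probability_waiting_time_prefix (R : realType) (d : measure_display)
    (Omega : measurableType d) (P : probability Omega R)
    (X : nat -> {RV P >-> bool}) (p : R) (k r n : nat) (t : seq bool) :
  bernoulli_trials X p -> (0 < k)%N -> (overlapping_runs k t < r)%N ->
  let A := [set w | mkseq (X ^~ w) (size t) = t /\
                    waiting_time r k (X ^~ w) = Some (size t + n)%N] in
  measurable A /\
  P A = (prefix_weight p t *
         hit_pmf p k n (r - overlapping_runs k t)
           (minn (trailing_successes t) k.-1))%:E.
Proof.
move=> trials k_gt0; elim: n t => [|n IH] t t_lt_r A.
  (* The waiting time cannot be [size t], as [t] still has fewer than [r] runs. *)
  have -> : A = set0.
    rewrite -subset0 => w [/= wt /waiting_timeP[]].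
    by rewrite addn0 wt leqNgt t_lt_r.
  split; first exact: measurable0.
  case: (r - _)%N (subn_gt0 (overlapping_runs k t) r) => [|m _].
    by rewrite t_lt_r.
  by rewrite /= mulr0 measure0.
pose C b := [set w | mkseq (X ^~ w) (size (rcons t b)) = rcons t b /\
              waiting_time r k (X ^~ w) = Some (size (rcons t b) + n)%N].
have AE : A = C true `|` C false.
  apply/seteqP; split=> w; rewrite /A /C /= !size_rcons mkseqS addSnnS.
    by case=> -> ->; case: (X (size t) w); [left|right].
  by case=> [] [/rcons_inj[-> _] ->].
have C_disj : C true `&` C false = set0.
  rewrite -subset0 => w [[/= wt _] [/= wf _]].
  by move: wt wf; rewrite !size_rcons => -> /rcons_inj[].
have [C_false_m P_false] : measurable (C false) /\
    P (C false) = (prefix_weight p t * (1 - p) *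
                   hit_pmf p k n (r - overlapping_runs k t) 0)%:E.
  have := IH (rcons t false).
  rewrite overlapping_runs_rcons // addn0 trailing_successes_rcons min0n.
  by rewrite prefix_weight_rcons; apply.
have [C_true_m P_true] : measurable (C true) /\
    P (C true) = (prefix_weight p t * p *
      (if ((minn (trailing_successes t) k.-1).+1 < k)%N
       then hit_pmf p k n (r - overlapping_runs k t)
              (minn (trailing_successes t) k.-1).+1
       else hit_pmf p k n (r - overlapping_runs k t).-1
              (minn (trailing_successes t) k.-1)))%:E.
  have := IH (rcons t true).
  rewrite overlapping_runs_rcons //= trailing_successes_rcons.
  rewrite prefix_weight_rcons.
  have [k_le|k_gt] := leqP k (trailing_successes t).+1; last first.
    rewrite addn0 => /(_ t_lt_r).
    rewrite (minn_idPl _); last by lia.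
    by rewrite (minn_idPl _) ?k_gt //; lia.
  rewrite (minn_idPr _); last by lia.
  rewrite (minn_idPr _); last by lia.
  rewrite prednK // ltnn addn1 subnS => IHt.
  (* If this success completes the [r]-th run, the induction hypothesis does not apply: the event is
     then the whole cylinder of the extended prefix when n = 0, and empty otherwise. *)
  have [r_le|r_gt] := leqP r (overlapping_runs k t).+1; last exact: IHt.
  have -> : ((r - overlapping_runs k t).-1 = 0)%N by lia.
  have [t'_m P_t'] := probability_prefix (rcons t true) trials.
  have r_def : r = overlapping_runs k (rcons t true).
    by rewrite overlapping_runs_rcons //= k_le; lia.
  rewrite hit_pmf0.
  have [n0|n_gt0] := posnP n; last first.
    have -> : C true = set0.
      rewrite -subset0 => w [/= wt /waiting_timeP[_ /(_ (size (rcons t true)))]].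
      by rewrite wt -r_def ltnn -[X in (X < _)%N]addn0 ltn_add2l => /(_ n_gt0).
    by rewrite mulr0 measure0.
  rewrite mulr1 -(prefix_weight_rcons p t true) -P_t'.
  suff -> : C true =
      [set w | mkseq (X ^~ w) (size (rcons t true)) = rcons t true] by [].
  apply/seteqP; split=> w /=; first by case.
  move=> wt; split=> //; apply/waiting_timeP; rewrite n0 addn0 wt.
  split=> [|m]; first by rewrite r_def.
  rewrite size_rcons ltnS => mt.
  apply: leq_ltn_trans t_lt_r.
  have wt' : mkseq (X ^~ w) (size t) = t.
    by move: wt; rewrite size_rcons mkseqS => /rcons_inj[].
  by rewrite -[X in (_ <= overlapping_runs k X)%N]wt' overlapping_runs_mkseq_mono.
split; first by rewrite AE; exact: measurableU.
have -> : P A = (P (C true) + P (C false))%E by rewrite AE; exact: measureU.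
rewrite P_true P_false -EFinD; congr EFin.
case: (r - _)%N (subn_gt0 (overlapping_runs k t) r) => [|m _].
  by rewrite t_lt_r.
by rewrite /=; ring.
Qed.

Lemma hIII_hit_pmfz (R : realType) (d : measure_display)
    (Omega : measurableType d) (P : probability Omega R)
    (X : nat -> {RV P >-> bool}) (p : R) (k r : nat) (n : int) :
  bernoulli_trials X p -> (0 < k)%N ->
  hIII X k r n = hit_pmfz p k r 0 n.
Proof.
move=> trials k_gt0; case: r => [|r]; first by rewrite hit_pmfz0.
case: n => n /=; last first.
  rewrite (_ : [set w | _] = set0) ?measure0 //.
  by rewrite -subset0 => w /=; case: waiting_time.
(* The empty prefix has weight 1, no runs and state 0. *)
have := @probability_waiting_time_prefix _ _ _ _ _ _ k r.+1 n [::] trials k_gt0.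
rewrite overlapping_runs_nil => /(_ isT)[_].
rewrite /prefix_weight big_nil mul1r min0n subn0 => P_eq.
rewrite -[RHS]/(fine (hit_pmf p k n r.+1 0)%:E) -P_eq.
congr (fine (P _)); apply/seteqP; split=> w /=.
  by case: waiting_time => // m [->].
by case=> _ ->.
Qed.

(* For r = 1 and k >= 2 the scheme fails at n = 1, 2, k, k + 1, for every
   0 < p < 1; these are the only excluded cases. *)
Theorem theorem3p7 (R : realType) (d : measure_display)
    (Omega : measurableType d) (P : probability Omega R)
    (X : nat -> {RV P >-> bool}) (p q : R) (k r : nat) (n : int) :
  0 < p < 1 -> q = 1 - p ->
  bernoulli_trials X p ->
  (1 <= k)%N -> (1 <= r)%N ->
  ~ (r = 1%N /\ (2 <= k)%N /\
     [\/ n = 1, n = 2, n = k%:Z | n = k%:Z + 1]) ->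
  hIII X k r n =
    hIII X k r (n - 1) - p ^+ k * q * hIII X k r (n - k%:Z - 1)
    + p * hIII X k r.-1 (n - 1) - p * hIII X k r.-1 (n - 2)
    + p ^+ k * q * hIII X k r.-1 (n - k%:Z - 1).
Proof.
move=> _ -> trials k_gt0 r_gt0 excl.
case: r r_gt0 excl => [//|r] _ excl.
rewrite !(hIII_hit_pmfz _ _ trials k_gt0); apply: hit_pmfz_rec => //.
by move=> [r0 H]; apply: excl; rewrite r0.
Qed.
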